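(* Let $(\beta,F_A,F_B)$ be any labor market. Without EPSW (i.e. with outcomes, blocking and core as defined in the context, with no equal-pay restriction), there exist a continuum of pairwise non-equivalent core outcomes. Moreover, in any core outcome $O=\{(f_g^i(v),w_i^g(v))\}_{v\in[0,1],\,i=1,2,\,g=A,B}$, almost every worker is employed and earns a wage equal to her productivity: for all $i\in\{1,2\}$, all $g\in\{A,B\}$ and almost all $v\in[0,1]$, $f_g^1(v)+f_g^2(v)=f_g(v)$, and $w_i^g(v)=v$ if $f_g^i(v)>0$.
   Context: Labor market. There are two firms, 1 and 2, and a continuum of workers. A worker has a type $(g,v)\in\{A,B\}\times[0,1]$ ($g$ = group, $v$ = productivity). There is a measure $\beta\ge 1$ of $A$-group workers and measure $1$ of $B$-group workers. Productivities in group $g$ are distributed with cdf $F_g$ on $[0,1]$, absolutely continuous with density $f_g$ satisfying $0<\inf_{v\in[0,1]} f_g(v)\le \sup_{v\in[0,1]} f_g(v)<\infty$. A (labor) market is a tuple $(\beta,F_A,F_B)$. Outcomes. An outcome for firm $i$ is $O_i=\{(f_g^i(v),w_i^g(v))\}_{v\in[0,1],\,g=A,B}$ with $f_g^i(v)\in[0,f_g(v)]$ (density of type-$(g,v)$ workers hired by $i$) and $w_i^g(v)\in[0,\infty)$ (wage paid by $i$ to them), where $w_i^g(v)=0$ by convention whenever $f_g^i(v)=0$; all these functions are measurable in $v$. An outcome is a pair $O=(O_1,O_2)$ with $f_g^1(v)+f_g^2(v)\le f_g(v)$ for all $v,g$. Firm $i$'s profit is $$\pi_i^{O}=\pi_i^{O_i}=\beta\int_0^1[v-w_i^A(v)]f_A^i(v)\,dv+\int_0^1[v-w_i^B(v)]f_B^i(v)\,dv.$$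 Equivalence. Two outcomes $O_i,\tilde O_i$ for a firm are equivalent if, for each $g$, $f_g^i(v)=\tilde f_g^i(v)$ and $w_i^g(v)=\tilde w_i^g(v)$ for almost all $v$. Two outcomes $O,\tilde O$ are equivalent if either $O_i$ is equivalent to $\tilde O_i$ for both $i$, or $O_1$ is equivalent to $\tilde O_2$ and $O_2$ is equivalent to $\tilde O_1$ (relabeling firms). Blocking and core. An outcome $O$ is blocked by firm $j$ via an outcome for $j$, $\tilde O_j=\{(\tilde f_g^j(v),\tilde w_j^g(v))\}_{v,g}$, if $\pi_j^{\tilde O_j}>\pi_j^{O_j}$ and, for each $g\in\{A,B\}$ and almost all $v\in[0,1]$, at least one of the following holds ($-j$ denotes the other firm): (1) $\tilde w_j^g(v)\ge w_j^g(v)$ and $\tilde w_j^g(v)>w_{-j}^g(v)$; (2) $\tilde w_j^g(v)\ge w_j^g(v)$ and $\tilde f_g^j(v)+f_g^{-j}(v)\le f_g(v)$; (3) $\tilde w_j^g(v)>w_{-j}^g(v)$ and $\tilde f_g^j(v)+f_g^j(v)\le f_g(v)$; (4) $\tilde f_g^j(v)+f_g^j(v)+f_g^{-j}(v)\le f_g(v)$. An outcome is a core outcome if it is not blocked by any firm via any outcome for that firm. ''Almost all'' is with respect to Lebesgue measure. *)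

(* Defs.v *)
From HB Require Import structures.
From mathcomp Require Import all_boot all_order all_algebra.
From mathcomp Require Import all_classical all_reals all_analysis.
Set Implicit Arguments.
Unset Strict Implicit.
Unset Printing Implicit Defensive.
Import Order.TTheory GRing.Theory Num.Theory.
Import numFieldNormedType.Exports.
Local Open Scope classical_set_scope.
Local Open Scope ring_scope.

Inductive group := grpA | grpB.

Inductive firm := firm1 | firm2.

Definition other (j : firm) : firm :=
  match j with firm1 => firm2 | firm2 => firm1 end.

(* Functions of the productivity v are total on R, but only their values on
   [0, 1] carry meaning: every condition below is restricted to [0, 1].
   Measurability is Borel measurability. *)

(* [mcdf M g] is F_g, a cdf on R with all its mass on [0, 1]; absolute
   continuity is given by the density [mdens M g], a chosen version of f_g.
   The infimum and supremum are genuine ones (not essential), taken in the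
   extended reals so that "0 < inf" and "sup < oo" have no junk values. *)
Record market (R : realType) := Market {
  mbeta : R ;
  mcdf : group -> cumulativeBounded (0 : R) (1 : R) ;
  mdens : group -> R -> R ;
  mbeta_ge1 : 1 <= mbeta ;
  mcdf1 : forall g, mcdf g 1 = 1 ;
  mdens_measurable : forall g, measurable_fun `[(0 : R), (1 : R)]%classic (mdens g) ;
  mdens_cdf : forall g (x : R), x \in `[0, 1] ->
    (mcdf g x)%:E =
      (\int[@lebesgue_measure R]_(v in `[0%R, x]) (mdens g v)%:E)%E ;
  mdens_inf : forall g,
    (0 < ereal_inf [set (mdens g v)%:E | v in `[0%R, 1%R]%classic])%E ;
  mdens_sup : forall g,
    (ereal_sup [set (mdens g v)%:E | v in `[0%R, 1%R]%classic] < +oo)%E }.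

(* For firm i: [hire Oi g v] is f_g^i(v) and [wage Oi g v] is w_i^g(v). *)
Record firm_outcome (R : realType) (M : market R) := FirmOutcome {
  hire : group -> R -> R ;
  wage : group -> R -> R ;
  hire_measurable : forall g, measurable_fun `[(0 : R), (1 : R)]%classic (hire g) ;
  wage_measurable : forall g, measurable_fun `[(0 : R), (1 : R)]%classic (wage g) ;
  hire_bounds : forall g (v : R), v \in `[0, 1] -> 0 <= hire g v <= mdens M g v ;
  wage_ge0 : forall g (v : R), v \in `[0, 1] -> 0 <= wage g v ;
  wage_unhired : forall g (v : R), v \in `[0, 1] -> hire g v = 0 -> wage g v = 0 }.

Record outcome (R : realType) (M : market R) := Outcome {
  firm_part :> firm -> firm_outcome M ;
  outcome_feasible : forall g (v : R), v \in `[0, 1] ->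
    hire (firm_part firm1) g v + hire (firm_part firm2) g v <= mdens M g v }.

(* Wages need not be integrable, so the profit is an extended real: the
   integrands are bounded above on [0, 1], hence each integral is well
   defined in [-oo, +oo[ and so is their weighted sum. *)
Definition profit (R : realType) (M : market R) (Oi : firm_outcome M) : \bar R :=
  ((mbeta M)%:E *
     \int[@lebesgue_measure R]_(v in `[0%R, 1%R])
       ((v - wage Oi grpA v) * hire Oi grpA v)%:E +
   \int[@lebesgue_measure R]_(v in `[0%R, 1%R])
       ((v - wage Oi grpB v) * hire Oi grpB v)%:E)%E.

Definition firm_equivalent (R : realType) (M : market R)
    (Oi Oi' : firm_outcome M) : Prop :=
  forall g, {ae @lebesgue_measure R, forall v : R, v \in `[0, 1] ->
    hire Oi g v = hire Oi' g v /\ wage Oi g v = wage Oi' g v}.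

Definition equivalent (R : realType) (M : market R) (O O' : outcome M) : Prop :=
  (firm_equivalent (O firm1) (O' firm1) /\ firm_equivalent (O firm2) (O' firm2))
  \/
  (firm_equivalent (O firm1) (O' firm2) /\ firm_equivalent (O firm2) (O' firm1)).

Definition blocked (R : realType) (M : market R) (O : outcome M) (j : firm)
    (D : firm_outcome M) : Prop :=
  (profit (O j) < profit D)%E /\
  forall g, {ae @lebesgue_measure R, forall v : R, v \in `[0, 1] ->
    [\/ wage (O j) g v <= wage D g v /\ wage (O (other j)) g v < wage D g v,
        wage (O j) g v <= wage D g v /\
          hire D g v + hire (O (other j)) g v <= mdens M g v,
        wage (O (other j)) g v < wage D g v /\
          hire D g v + hire (O j) g v <= mdens M g v
      | hire D g v + hire (O j) g v + hire (O (other j)) g v <= mdens M g v]}.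

Definition core (R : realType) (M : market R) (O : outcome M) : Prop :=
  ~ exists (j : firm) (D : firm_outcome M), blocked O j D.

(* Main.v *)
Require Import Defs.
From mathcomp Require Import all_boot all_order all_algebra.
From mathcomp Require Import all_classical all_reals all_analysis.
From mathcomp Require Import measurable_realfun ring lra.
Import Order.TTheory GRing.Theory Num.Theory.
Import numFieldNormedType.Exports.
Local Open Scope classical_set_scope.
Local Open Scope ring_scope.

(* Any local improvement of a firm on a non-null set of workers that respects
   (1)-(4) can be turned into a blocking outcome, so it suffices to exhibit, for
   each failure of the conclusion, a firm that can improve pointwise: drop
   workers paid above their productivity; hire the unemployed, at wage 0 by (4)
   if the firm makes no profit there, otherwise at the current wage by (2); if
   the rival earns [v - w > 0] on workers where the firm itself has no profit,
   replace the rival by (3) at wage [(w + v) / 2]; if both firms profit, the one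
   with the higher wage poaches everybody by (1) at a slightly higher wage.
   Conversely, full employment at productivity wages leaves no room for a
   profit, and splitting every type in proportion c : 1 - c with
   0 < c < 1/2 yields a continuum of such outcomes. *)

(** * Integrals of functions that need not be integrable *)

Section integral_comparison.
Local Open Scope ereal_scope.
Context d (T : measurableType d) (R : realType).
Context (mu : {measure set T -> \bar R}).
Context (D : set T) (mD : measurable D) (p q : T -> R).
Hypotheses (mp : measurable_fun D p) (iq : mu.-integrable D (EFin \o q)).
Hypotheses (q0 : forall x, D x -> (0 <= q x)%R).
Hypotheses (pq : forall x, D x -> (p x <= q x)%R).

Let mep : measurable_fun D (EFin \o p).
Proof. exact/measurable_EFinP. Qed.

Let le_funepos_integral :
  \int[mu]_(x in D) (EFin \o p)^\+ x <= \int[mu]_(x in D) (q x)%:E.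
Proof.
apply: ge0_le_integral => //.
- exact: measurable_funepos.
- exact: measurable_int iq.
- by move=> x Dx; rewrite funeposE ge_max !lee_fin pq// q0.
Qed.

(** Integrability of [p] is not assumed: dropping its negative part can only raise the integral, and
    its positive part lies below [q]. *)
Lemma ge0_dominated_le_integral :
  \int[mu]_(x in D) (p x)%:E <= \int[mu]_(x in D) (q x)%:E.
Proof.
apply: le_trans le_funepos_integral; rewrite integralE.
by rewrite geeDl// oppe_le0 integral_ge0.
Qed.

(** The reverse inequality makes the integral of [p] nonnegative, which rules out -oo and makes [p]
    integrable. Then [q - p] is nonnegative with integral zero. *)
Lemma ge0_dominated_ae_eq :
  \int[mu]_(x in D) (q x)%:E <= \int[mu]_(x in D) (p x)%:E -> ae_eq mu D p q.
Proof.
move=> qp.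
have qfin : \int[mu]_(x in D) (q x)%:E \is a fin_num by exact: integrable_fin_num.
have Ip0 : 0 <= \int[mu]_(x in D) (p x)%:E.
  by apply: le_trans qp; apply: integral_ge0 => x Dx; rewrite lee_fin q0.
have posy : \int[mu]_(x in D) (EFin \o p)^\+ x < +oo.
  by rewrite (le_lt_trans le_funepos_integral)// ltey_eq qfin.
have negy : \int[mu]_(x in D) (EFin \o p)^\- x < +oo.
  move: Ip0 posy; rewrite integralE;
    case: (\int[mu]_(x in D) (EFin \o p)^\- x) => //.
  - by move=> r; rewrite ltry.
  - by case: (\int[mu]_(x in D) (EFin \o p)^\+ x).
have ip : mu.-integrable D (EFin \o p).
  apply/integrableP; split=> //.
  rewrite (eq_integral ((EFin \o p)^\+ \+ (EFin \o p)^\-)); last first.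
    by move=> x _; rewrite -/((abse \o (EFin \o p)) x) fune_abse.
  rewrite ge0_integralD//; first by rewrite lte_add_pinfty.
  - exact: measurable_funepos.
  - exact: measurable_funeneg.
have IB : \int[mu]_(x in D) `|((EFin \o q) \- (EFin \o p)) x| = 0.
  rewrite (eq_integral ((EFin \o q) \- (EFin \o p))).
    rewrite integralB//; apply/eqP; rewrite eq_le.
    rewrite leeBlDr ?integrable_fin_num// add0e qp/= sube_ge0 ?qfin ?orbT//.
    by rewrite ge0_dominated_le_integral.
  by move=> x; rewrite inE => Dx; rewrite gee0_abs// lee_fin subr_ge0 pq.
have /ae_eq_integral_abs : measurable_fun D ((EFin \o q) \- (EFin \o p)).
  by apply: emeasurable_funB => //; exact: measurable_int iq.
move=> /(_ mu mD)[/(_ IB) + _]; apply: filterS => x /[apply] /= -[] /eqP.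
by rewrite subr_eq0 => /eqP.
Qed.
End integral_comparison.

(** The positive part vanishes almost everywhere, and the negative part can only lower the integral,
    possibly to -oo. *)
Lemma ae_le0_integral d (T : measurableType d) (R : realType)
    (mu : {measure set T -> \bar R}) (D : set T) (p : T -> \bar R) :
  measurable D -> measurable_fun D p ->
  {ae mu, forall x, D x -> (p x <= 0)%E} ->
  (\int[mu]_(x in D) p x <= 0)%E.
Proof.
move=> mD mp p0; rewrite integralE.
have -> : (\int[mu]_(x in D) p^\+ x = 0)%E.
  rewrite -[RHS](integral0 mu D); apply: ae_eq_integral => //.
    exact: measurable_funepos.
  by apply: filterS p0 => x /[apply] p0; rewrite funeposE max_r.
by rewrite add0e oppe_le0 integral_ge0.
Qed.

(** Meant for sums of profits over the two groups: [a] and [b] may be -oo, and finiteness of [x] and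
    [y] keeps the inequality strict. *)
Lemma lt_fin_leD (R : realDomainType) (a b x y : \bar R) :
  x \is a fin_num -> y \is a fin_num ->
  (a < x -> b <= y -> a + b < x + y)%E.
Proof.
move: a b x y => [a||] [b||] [x||] [y||] // _ _.
- by rewrite lte_fin lee_fin; exact: ltr_leD.
all: by move=> *; rewrite ?addNye ?addeNy -EFinD ltNyr.
Qed.

(** * Bounds on the density and comparison of profits *)

Section market_facts.
Context (R : realType) (M : market R).
Implicit Types (g : group) (v : R).

#[local] Instance lebesgue_ae_filter :
  Filter (nbhs (almost_everywhere (@lebesgue_measure R))).
Proof. exact: ae_filter_ringOfSetsType. Qed.

Lemma mdens_gt0 g v : v \in `[0, 1] -> 0 < mdens M g v.
Proof.
move=> v01; rewrite -lte_fin; apply: lt_le_trans (mdens_inf M g) _.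
by apply: ereal_inf_lbound; exists v.
Qed.

Lemma mdens_bounded : exists K : R,
  forall g v, v \in `[0, 1] -> mdens M g v <= K.
Proof.
suff bnd g : exists K : R, forall v, v \in `[0, 1] -> mdens M g v <= K.
  have [[KA fA] [KB fB]] := (bnd grpA, bnd grpB).
  by exists (Num.max KA KB) => -[] v v01; rewrite le_max ?fA ?fB ?orbT.
have ub v : v \in `[0, 1] -> ((mdens M g v)%:E <=
    ereal_sup [set (mdens M g v)%:E | v in `[0%R, 1%R]%classic])%E.
  by move=> v01; apply: ereal_sup_ubound; exists v.
move: (mdens_sup M g) ub; case: ereal_sup => [K _ ub|//|_ ub].
  by exists K => v /ub; rewrite lee_fin.
by exists 0 => v /ub.
Qed.

Lemma measurable_profit_density (h w : R -> R) :
  measurable_fun `[(0 : R), (1 : R)]%classic h ->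
  measurable_fun `[(0 : R), (1 : R)]%classic w ->
  measurable_fun `[(0 : R), (1 : R)]%classic (fun v => (v - w v) * h v).
Proof.
move=> mh mw; apply: measurable_funM => //.
by apply: measurable_funB => //; exact: measurable_id.
Qed.

(** The profit density of [D] is bounded, so its integrals are finite and a strict gain in one group
    would survive in the weighted sum. Without such a gain the integrals agree, and hence the
    densities do almost everywhere. *)
Lemma profit_lt (Oi D : firm_outcome M) :
  (forall g v, v \in `[0, 1] -> 0 <= (v - wage D g v) * hire D g v) ->
  (forall g v, v \in `[0, 1] ->
     (v - wage Oi g v) * hire Oi g v <= (v - wage D g v) * hire D g v) ->
  ~ (profit Oi < profit D)%E ->
  forall g, {ae @lebesgue_measure R, forall v : R, v \in `[0, 1] ->
     (v - wage Oi g v) * hire Oi g v = (v - wage D g v) * hire D g v}.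
Proof.
move=> D0 OD nlt.
pose p g v := (v - wage Oi g v) * hire Oi g v.
pose q g v := (v - wage D g v) * hire D g v.
have mp g : measurable_fun `[(0 : R), (1 : R)]%classic (p g).
  by apply: measurable_profit_density;
    [exact: hire_measurable|exact: wage_measurable].
have mq g : measurable_fun `[(0 : R), (1 : R)]%classic (q g).
  by apply: measurable_profit_density;
    [exact: hire_measurable|exact: wage_measurable].
have iq g : (@lebesgue_measure R).-integrable `[0%R, 1%R] (EFin \o q g).
  apply: measurable_bounded_integrable => //.
    by rewrite /= lebesgue_measure_itv /= lte_fin ltr01 oppr0 adde0 ltry.
    exact: mq.
  have [K fK] := mdens_bounded.
  rewrite /bounded_near; near=> x => v /= v01; rewrite ger0_norm ?D0//.
  have /andP[h0 hf] := hire_bounds D g v01.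
  have w0 := wage_ge0 D g v01.
  have hK := fK g _ v01.
  move: (v01); rewrite in_itv /= => /andP[v0 v1].
  apply: (@le_trans _ _ K); last by near: x; exact: nbhs_pinfty_ge (num_real K).
  (* The margin [v - wage D g v] is at most 1, because [v <= 1] and wages are nonnegative. *)
  by apply: le_trans (le_trans hf hK); rewrite ler_piMl//; lra.
have le g := @ge0_dominated_le_integral _ _ _ (@lebesgue_measure R) _
  (measurable_itv _) (p g) (q g) (mp g) (iq g) (D0 g) (OD g).
have qfin g : (\int[@lebesgue_measure R]_(v in `[0%R, 1%R]) (q g v)%:E)%E \is a fin_num.
  exact: integrable_fin_num (iq g).
have b0 : 0 < mbeta M by rewrite (lt_le_trans ltr01)// mbeta_ge1.
have ae g : (\int[@lebesgue_measure R]_(v in `[0%R, 1%R]) (q g v)%:E <=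
    \int[@lebesgue_measure R]_(v in `[0%R, 1%R]) (p g v)%:E)%E.
  rewrite leNgt; apply/negP => lt; apply: nlt; rewrite /profit.
  move: g lt => [|] lt.
  - by apply: lt_fin_leD; rewrite ?fin_numM ?qfin ?lte_pmul2l//; exact: le.
  - by rewrite addeC [ltRHS]addeC; apply: lt_fin_leD;
      rewrite ?fin_numM ?qfin// lee_pmul2l//; exact: le.
move=> g; exact: (@ge0_dominated_ae_eq _ _ _ (@lebesgue_measure R) _
  (measurable_itv _) (p g) (q g) (mp g) (iq g) (D0 g) (OD g) (ae g)).
Unshelve. all: by end_near.
Qed.

(** * From pointwise improvements to blocking outcomes *)

Lemma measurable_patch (b : R -> bool) (h k : R -> R) :
  measurable_fun `[(0 : R), (1 : R)]%classic b ->
  measurable_fun `[(0 : R), (1 : R)]%classic h ->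
  measurable_fun `[(0 : R), (1 : R)]%classic k ->
  measurable_fun `[(0 : R), (1 : R)]%classic (fun v => if b v then h v else k v).
Proof.
move=> mb mh mk; apply: measurable_fun_if => //.
- by apply: measurable_funS mh.
- by apply: measurable_funS mk.
Qed.

(** The pointwise part of [blocked], stated for numbers [h] and [w] so that it can be checked before
    a deviating outcome is assembled. *)
Definition wage_hire_dominates (O : outcome M) (j : firm) g v (h w : R) :=
  [\/ wage (O j) g v <= w /\ wage (O (other j)) g v < w,
      wage (O j) g v <= w /\ h + hire (O (other j)) g v <= mdens M g v,
      wage (O (other j)) g v < w /\ h + hire (O j) g v <= mdens M g v
    | h + hire (O j) g v + hire (O (other j)) g v <= mdens M g v].

Lemma outcome_feasible_other (O : outcome M) j g v : v \in `[0, 1] ->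
  hire (O j) g v + hire (O (other j)) g v <= mdens M g v.
Proof.
move=> v01; have := outcome_feasible O g v01.
by case: j => //=; rewrite addrC.
Qed.

(* The deviation pays [(h, w)] on [b], and elsewhere drops the workers on
   whom [j] makes a loss; its profit density is then nonnegative, so that the
   comparison makes sense even if the profit of [j] in [O] is -oo. *)
Lemma core_no_local_improvement (O : outcome M) (j : firm)
    (b : group -> R -> bool) (h w : group -> R -> R) :
  core O ->
  (forall g, measurable_fun `[(0 : R), (1 : R)]%classic (b g)) ->
  (forall g, measurable_fun `[(0 : R), (1 : R)]%classic (h g)) ->
  (forall g, measurable_fun `[(0 : R), (1 : R)]%classic (w g)) ->
  (forall g v, v \in `[0, 1] -> b g v ->
    [/\ 0 <= h g v <= mdens M g v,
        0 <= w g v, (h g v = 0 -> w g v = 0),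
        wage_hire_dominates O j g v (h g v) (w g v)
      & 0 <= (v - w g v) * h g v
        /\ (v - wage (O j) g v) * hire (O j) g v < (v - w g v) * h g v]) ->
  forall g, {ae @lebesgue_measure R, forall v : R, v \in `[0, 1] -> ~~ b g v}.
Proof.
move=> coreO mb mh mw bP.
pose keep g v := 0 <= (v - wage (O j) g v) * hire (O j) g v.
have mkeep g : measurable_fun `[(0 : R), (1 : R)]%classic (keep g).
  apply: measurable_fun_ler => //; apply: measurable_profit_density.
  - exact: hire_measurable.
  - exact: wage_measurable.
pose hD g v := if b g v then h g v else if keep g v then hire (O j) g v else 0.
pose wD g v := if b g v then w g v else if keep g v then wage (O j) g v else 0.
have mhD g : measurable_fun `[(0 : R), (1 : R)]%classic (hD g).
  by do 2 ![apply: measurable_patch => //]; exact: hire_measurable.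
have mwD g : measurable_fun `[(0 : R), (1 : R)]%classic (wD g).
  by do 2 ![apply: measurable_patch => //]; exact: wage_measurable.
have hD_bounds g v : v \in `[0, 1] -> 0 <= hD g v <= mdens M g v.
  move=> v01; rewrite /hD; case: ifP => [/bP[]//|_].
  by case: ifP => _; [exact: hire_bounds|rewrite lexx ltW ?mdens_gt0].
have wD_ge0 g v : v \in `[0, 1] -> 0 <= wD g v.
  move=> v01; rewrite /wD; case: ifP => [/bP[]//|_].
  by case: ifP => _ //; exact: wage_ge0.
have wD_unhired g v : v \in `[0, 1] -> hD g v = 0 -> wD g v = 0.
  move=> v01; rewrite /wD /hD; case: ifP => [/bP[]//|_].
  by case: ifP => _ //; exact: wage_unhired.
pose D := FirmOutcome mhD mwD hD_bounds wD_ge0 wD_unhired.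
have profD g v : v \in `[0, 1] ->
    0 <= (v - wD g v) * hD g v /\
    (v - wage (O j) g v) * hire (O j) g v <= (v - wD g v) * hD g v.
  move=> v01; rewrite /wD /hD; case: ifPn => [/bP[]// _ _ _ _ [q0 /ltW]//|_].
  by case: ifPn => //; rewrite /keep -ltNge mulr0 => /ltW.
have nlt : ~ (profit (O j) < profit D)%E.
  move=> lt; apply: coreO; exists j, D; split=> // g; apply: aeW => v v01 /=.
  rewrite /wD /hD; case: ifPn => [/bP[]//|_].
  have feas := outcome_feasible_other O j g v v01.
  (* Workers kept on unchanged terms satisfy (2) and dropped ones (4), in both cases by feasibility
     of [O]. *)
  by case: ifPn => _; [apply: Or42|apply: Or44; rewrite add0r].
(* As [D] cannot raise the profit, the densities agree almost everywhere; on [b] they differ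
   strictly, so [b] is null. *)
move=> g; have eqp := profit_lt (O j) D (fun g v v01 => (profD g v v01).1)
  (fun g v v01 => (profD g v v01).2) nlt g.
apply: filterS eqp => v eqp v01; apply/negP => bv.
have [_ _ _ _ [_]] := bP g v v01 bv.
by have := eqp v01; rewrite /= /wD /hD bv => ->; rewrite ltxx.
Qed.

(** * Employment and wages in a core outcome *)

Section core_outcome.
Context (O : outcome M) (coreO : core O).

Let mwage i g : measurable_fun `[(0 : R), (1 : R)]%classic (wage (O i) g).
Proof. exact: wage_measurable. Qed.

Let mhire i g : measurable_fun `[(0 : R), (1 : R)]%classic (hire (O i) g).
Proof. exact: hire_measurable. Qed.

Let mdensM g : measurable_fun `[(0 : R), (1 : R)]%classic (mdens M g).
Proof. exact: mdens_measurable. Qed.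

Let mprofit i g : measurable_fun `[(0 : R), (1 : R)]%classic
  (fun v => (v - wage (O i) g v) * hire (O i) g v).
Proof. exact: measurable_profit_density. Qed.

Let mid : measurable_fun `[(0 : R), (1 : R)]%classic (fun v : R => v).
Proof. exact: measurable_id. Qed.

Lemma core_no_loss j g : {ae @lebesgue_measure R, forall v : R, v \in `[0, 1] ->
  0 < hire (O j) g v -> wage (O j) g v <= v}.
Proof.
pose b g v := (0 < hire (O j) g v) && (v < wage (O j) g v).
have H := @core_no_local_improvement O j b (fun _ _ => 0) (fun _ _ => 0) coreO.
have {}H : {ae @lebesgue_measure R, forall v : R, v \in `[0, 1] -> ~~ b g v}.
  apply: H => //.
  - by move=> g'; apply: measurable_and; exact: measurable_fun_ltr.
  - move=> g' v v01 /andP[h0 wv]; split => //.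
    + by rewrite lexx ltW// mdens_gt0.
    + by apply: Or44; rewrite add0r outcome_feasible_other.
    + by rewrite mulr0 lexx nmulr_rlt0// subr_lt0.
apply: filterS H => v nb v01 h0; have := nb v01.
by rewrite /b h0/= -leNgt.
Qed.

Let unemp g v := mdens M g v - (hire (O firm1) g v + hire (O firm2) g v).

Let munemp g : measurable_fun `[(0 : R), (1 : R)]%classic (unemp g).
Proof. by apply: measurable_funB => //; exact: measurable_funD. Qed.

(** The sign of the profit density [p] of [firm1] decides the deviation. If [p <= 0], it gives up
    its own workers for the unemployed at wage 0; if [p > 0], it keeps them and adds the unemployed
    at the same wage. *)
Lemma core_full_employment g : {ae @lebesgue_measure R, forall v : R, v \in `[0, 1] ->
  hire (O firm1) g v + hire (O firm2) g v = mdens M g v}.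
Proof.
pose p g v := (v - wage (O firm1) g v) * hire (O firm1) g v.
have mp g' : measurable_fun `[(0 : R), (1 : R)]%classic (p g') by exact: mprofit.
(* Productivity 0 is left out, since hiring it at wage 0 earns nothing; it is a null set, handled by
   [ae0]. *)
pose b1 g v := (0 < v) && ((0 < unemp g v) && (p g v <= 0)).
pose b2 g v := (0 < unemp g v) && (0 < p g v).
have ae0 : {ae @lebesgue_measure R, forall v : R, v <> 0}.
  exists [set 0]; split => //; first exact: lebesgue_measure_set1.
  by move=> v /= /contrapT.
have ae1 := @core_no_local_improvement O firm1 b1 unemp (fun _ _ => 0) coreO.
have ae2 := @core_no_local_improvement O firm1 b2
  (fun g v => hire (O firm1) g v + unemp g v) (wage (O firm1)) coreO.
have {}ae1 : {ae @lebesgue_measure R, forall v : R, v \in `[0, 1] -> ~~ b1 g v}.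
  apply: ae1 => //.
  - move=> g'; apply: measurable_and; first exact: measurable_fun_ltr.
    by apply: measurable_and; [exact: measurable_fun_ltr|exact: measurable_fun_ler].
  - move=> g' v v01 /and3P[v0 u0 p0].
    have /andP[h1 _] := hire_bounds (O firm1) g' v01.
    have /andP[h2 _] := hire_bounds (O firm2) g' v01.
    have up : 0 < v * unemp g' v by exact: mulr_gt0.
    split => //.
    + by rewrite /unemp in u0 *; lra.
    + by apply: Or44; rewrite /unemp /=; lra.
    + by rewrite subr0 (ltW up) (le_lt_trans p0 up).
have {}ae2 : {ae @lebesgue_measure R, forall v : R, v \in `[0, 1] -> ~~ b2 g v}.
  apply: ae2 => //.
  - by move=> g'; apply: measurable_and; exact: measurable_fun_ltr.
  - by move=> g'; exact: measurable_funD.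
  - move=> g' v v01 /andP[u0 p0].
    have /andP[h1 _] := hire_bounds (O firm1) g' v01.
    have /andP[h2 _] := hire_bounds (O firm2) g' v01.
    have wv : 0 < v - wage (O firm1) g' v.
      by rewrite ltNge; apply/negP => wv; move: p0; rewrite ltNge mulr_le0_ge0.
    have up := mulr_gt0 wv u0.
    split.
    + by rewrite /unemp in u0 *; lra.
    + exact: wage_ge0.
    + by move: u0 => /[swap] ?; lra.
    + by apply: Or42; split => //; rewrite /unemp /=; lra.
    + by rewrite /p in p0; rewrite mulrDr; lra.
apply: filterS3 ae0 ae1 ae2 => v /eqP v_neq0 nb1 nb2 v01.
have v0 : 0 < v by rewrite lt_neqAle eq_sym v_neq0; move: v01; rewrite in_itv => /andP[].
have := outcome_feasible O g v01; have := nb1 v01; have := nb2 v01.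
rewrite /b1 /b2 v0 /=.
have [p0|p0] := leP (p g v) 0; rewrite ?andbT -?leNgt /unemp; lra.
Qed.

(** Firm [j] copies the rival's hires and lets its own workers go, so the hiring bound in (3) is
    feasibility of [O]. The midpoint wage beats the rival and still leaves a margin. *)
Lemma core_wage_ge_of_no_profit j g : {ae @lebesgue_measure R, forall v : R,
  v \in `[0, 1] -> (v - wage (O j) g v) * hire (O j) g v <= 0 ->
  0 < hire (O (other j)) g v -> v <= wage (O (other j)) g v}.
Proof.
set i := other j.
pose p g v := (v - wage (O j) g v) * hire (O j) g v.
have mp g' : measurable_fun `[(0 : R), (1 : R)]%classic (p g') by exact: mprofit.
pose b g v := (p g v <= 0) && ((0 < hire (O i) g v) && (wage (O i) g v < v)).
have := @core_no_local_improvement O j b (hire (O i))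
  (fun g v => (wage (O i) g v + v) / 2) coreO.
move=> H; have {}H : {ae @lebesgue_measure R, forall v : R, v \in `[0, 1] -> ~~ b g v}.
  apply: H => //.
  - move=> g'; apply: measurable_and; first exact: measurable_fun_ler.
    by apply: measurable_and; exact: measurable_fun_ltr.
  - by move=> g'; apply: measurable_funM => //; exact: measurable_funD.
  - move=> g' v v01 /and3P[p0 hi wi].
    have wi0 := wage_ge0 (O i) g' v01.
    have up : 0 < (v - (wage (O i) g' v + v) / 2) * hire (O i) g' v.
      by apply: mulr_gt0 => //; lra.
    split.
    + exact: hire_bounds.
    + by lra.
    + by move=> hi0; rewrite hi0 ltxx in hi.
    + apply: Or43; split; first by rewrite -/i; lra.
      by rewrite addrC outcome_feasible_other.
    + by rewrite (ltW up) (le_lt_trans p0 up).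
apply: filterS H => v nb v01 pj hi; have := nb v01.
by rewrite /b /p pj hi /= -leNgt.
Qed.

(** Firm [j] hires the whole density at its own wage plus [raise], which beats both current wages as
    (1) asks. The rival's positive hires leave a positive mass to gain, and [raise] is scaled so
    that paying it to everybody costs at most half of that gain. *)
Lemma core_wage_ge_of_underbid j g : {ae @lebesgue_measure R, forall v : R,
  v \in `[0, 1] -> 0 < hire (O (other j)) g v -> 0 < hire (O j) g v ->
  wage (O (other j)) g v <= wage (O j) g v -> v <= wage (O j) g v}.
Proof.
set i := other j.
pose b g v := (0 < hire (O i) g v) && ((0 < hire (O j) g v) &&
  ((wage (O i) g v <= wage (O j) g v) && (wage (O j) g v < v))).
have [K fK] := mdens_bounded.
(* The uniform bound [K] replaces the density in the denominator, which
   avoids the measurability of the inverse. *)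
pose raise g v :=
  (v - wage (O j) g v) * ((mdens M g v - hire (O j) g v) / (2 * K)).
have H := @core_no_local_improvement O j b (mdens M)
  (fun g v => wage (O j) g v + raise g v) coreO.
have {}H : {ae @lebesgue_measure R, forall v : R, v \in `[0, 1] -> ~~ b g v}.
  apply: H => //.
  - move=> g'; apply: measurable_and; first exact: measurable_fun_ltr.
    apply: measurable_and; first exact: measurable_fun_ltr.
    by apply: measurable_and; [exact: measurable_fun_ler|exact: measurable_fun_ltr].
  - move=> g'; apply: measurable_funD => //; apply: measurable_funM.
      exact: measurable_funB.
    by apply: measurable_funM => //; exact: measurable_funB.
  - move=> g' v v01 /and4P[hi hj wij wj].
    have f0 := mdens_gt0 g' v v01.
    have feas := outcome_feasible_other O j g' v v01.
    have wj0 := wage_ge0 (O j) g' v01.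
    have fKv := fK g' v v01.
    have r0 : 0 < raise g' v.
      rewrite /raise !mulr_gt0// ?invr_gt0 ?mulr_gt0//;
        last exact: lt_le_trans fKv.
      + by rewrite subr_gt0.
      + by rewrite -/i in feas; lra.
    have lt_prof : (v - wage (O j) g' v) * hire (O j) g' v <
        (v - (wage (O j) g' v + raise g' v)) * mdens M g' v.
      have -> : (v - (wage (O j) g' v + raise g' v)) * mdens M g' v =
          (v - wage (O j) g' v) * (mdens M g' v -
            (mdens M g' v - hire (O j) g' v) / 2 * (mdens M g' v / K)).
        by rewrite /raise; field; rewrite gt_eqF// (lt_le_trans f0).
      rewrite ltr_pM2l ?subr_gt0//.
      have fK1 : mdens M g' v / K <= 1.
        by rewrite ler_pdivrMr ?mul1r// (lt_le_trans f0).
      have df : 0 < (mdens M g' v - hire (O j) g' v) / 2.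
        by rewrite -/i in feas; lra.
      have := ler_piMr (ltW df) fK1; lra.
    split.
    + by rewrite lexx ltW.
    + by lra.
    + by move=> fE; rewrite fE ltxx in f0.
    + by apply: Or41; rewrite -/i; lra.
    + by split=> //; apply: le_trans (ltW lt_prof); rewrite mulr_ge0; lra.
apply: filterS H => v nb v01 hi hj wij; have := nb v01.
by rewrite /b hi hj wij /= -leNgt.
Qed.

(** The upper bound is [core_no_loss]. For the lower one, a rival without profit would take over the
    workers of [i]. A rival with profit pays less than [v], so it cannot be the higher bidder; then
    [i] bids at least as much, and its own option to poach forces the wage up to [v]. *)
Lemma core_wage i g : {ae @lebesgue_measure R, forall v : R, v \in `[0, 1] ->
  0 < hire (O i) g v -> wage (O i) g v = v}.
Proof.
have otherK : other (other i) = i by case: (i).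
have ub := core_no_loss i g.
have np := core_wage_ge_of_no_profit (other i) g; rewrite otherK in np.
have ui := core_wage_ge_of_underbid i g.
have uj := core_wage_ge_of_underbid (other i) g; rewrite otherK in uj.
apply: filterS2 (filterI ub np) (filterI ui uj) => v [{}ub {}np] [{}ui {}uj] v01 hi.
apply/eqP; rewrite eq_le ub//=.
have [p0|p0] := leP ((v - wage (O (other i)) g v) * hire (O (other i)) g v) 0.
  exact: np.
have /andP[hj0 _] := hire_bounds (O (other i)) g v01.
have hj : 0 < hire (O (other i)) g v.
  by rewrite lt_neqAle hj0 andbT; apply: contraTneq p0 => <-; rewrite mulr0 ltxx.
have wj : wage (O (other i)) g v < v by rewrite -subr_gt0 -(pmulr_lgt0 _ hj).
have [wij|/ltW wij] := leP (wage (O (other i)) g v) (wage (O i) g v).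
  exact: ui.
by have := uj v01 hi hj wij; rewrite leNgt wj.
Qed.

End core_outcome.


(** * Sufficiency of full employment at productivity wages *)

Lemma productivity_wage_core (O : outcome M) :
  (forall g, {ae @lebesgue_measure R, forall v : R, v \in `[0, 1] ->
     hire (O firm1) g v + hire (O firm2) g v = mdens M g v}) ->
  (forall i g, {ae @lebesgue_measure R, forall v : R, v \in `[0, 1] ->
     0 < hire (O i) g v -> wage (O i) g v = v}) ->
  core O.
Proof.
move=> full wE [j [D [lt dom]]].
have b0 : 0 < mbeta M by rewrite (lt_le_trans ltr01)// mbeta_ge1.
have measp (E : firm_outcome M) g : measurable_fun `[(0 : R), (1 : R)]%classic
    (fun v => ((v - wage E g v) * hire E g v)%:E).
  apply/measurable_EFinP; apply: measurable_profit_density.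
  - exact: hire_measurable.
  - exact: wage_measurable.
(* Where [j] hires nobody the integrand vanishes, and elsewhere the margin does. *)
have zero g : (\int[@lebesgue_measure R]_(v in `[0%R, 1%R])
    ((v - wage (O j) g v) * hire (O j) g v)%:E = 0)%E.
  rewrite -[RHS](integral0 (@lebesgue_measure R) `[0%R, 1%R]).
  apply: ae_eq_integral => //; first exact: measp.
  apply: filterS (wE j g) => v wE' v01; congr EFin.
  have /andP[+ _] := hire_bounds (O j) g v01.
  rewrite le_eqVlt => /predU1P[<-|/(wE' v01) ->]; first by rewrite mulr0.
  by rewrite subrr mul0r.
have npos g : (\int[@lebesgue_measure R]_(v in `[0%R, 1%R])
    ((v - wage D g v) * hire D g v)%:E <= 0)%E.
  apply: ae_le0_integral => //; first exact: measp.
  apply: filterS2 (filterI (full g) (dom g)) (filterI (wE j g) (wE (other j) g)).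
  move=> v [{}full {}dom] [wj wi] v01.
  have f0 := mdens_gt0 g v v01.
  have {}full : hire (O j) g v + hire (O (other j)) g v = mdens M g v.
    by rewrite -full//; case: (j) => //=; rewrite addrC.
  have /andP[hj _] := hire_bounds (O j) g v01.
  have /andP[hi _] := hire_bounds (O (other j)) g v01.
  have /andP[hD _] := hire_bounds D g v01.
  have {}wj := wj v01; have {}wi := wi v01.
  rewrite lee_fin.
  suff [vw|h0] : v <= wage D g v \/ hire D g v <= 0.
  - by rewrite mulr_le0_ge0// subr_le0.
  - by rewrite (_ : hire D g v = 0) ?mulr0//; apply/eqP; rewrite eq_le h0.
  (* The density is positive, so somebody hires at [v], at wage [v]. Each of (1)-(4) then either
     makes [D] pay at least [v] or leaves it no worker to hire. *)
  have [hj0|hj0] := ltP 0 (hire (O j) g v);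
    have [hi0|hi0] := ltP 0 (hire (O (other j)) g v);
    rewrite ?(wj hj0) ?(wi hi0) in dom;
    by case: (dom v01) => [[]|[]|[]|]; lra.
move: lt; apply/negP; rewrite -leNgt /profit !zero mule0 adde0.
by rewrite adde_le0// mule_ge0_le0// lee_fin ltW.
Qed.

(** * A continuum of non-equivalent proportional splits *)

Section proportional_split.
Variables (c : R) (c_gt0 : 0 < c) (c_lt1 : c < 1).

Let share_hire (a : R) g v := a * mdens M g v.

Let share_measurable a g :
  measurable_fun `[(0 : R), (1 : R)]%classic (share_hire a g).
Proof. by apply: measurable_funM => //; exact: mdens_measurable. Qed.

Let wage_measurable_id (g : group) :
  measurable_fun `[(0 : R), (1 : R)]%classic (fun v : R => v).
Proof. exact: measurable_id. Qed.

Let share_bounds a : 0 < a < 1 ->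
  forall g v, v \in `[0, 1] -> 0 <= share_hire a g v <= mdens M g v.
Proof.
move=> /andP[a0 a1] g v /(mdens_gt0 g) f0.
by rewrite mulr_ge0 ?ltW//= gtr_pMl.
Qed.

Let wage_id_ge0 (g : group) v : v \in `[0, 1] -> 0 <= v.
Proof. by rewrite in_itv => /andP[]. Qed.

(** Vacuous: a positive share of a positive density is never zero, so paying [v] respects the
    convention on unhired types. *)
Let share_unhired a : 0 < a < 1 ->
  forall g v, v \in `[0, 1] -> share_hire a g v = 0 -> v = 0.
Proof.
move=> /andP[a0 _] g v /(mdens_gt0 g) f0 /eqP.
by rewrite gt_eqF// mulr_gt0.
Qed.

Let share_outcome a (a01 : 0 < a < 1) : firm_outcome M :=
  FirmOutcome (share_measurable a) wage_measurable_id (share_bounds a a01)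
    wage_id_ge0 (share_unhired a a01).

Let c01 : 0 < c < 1. Proof. by rewrite c_gt0 c_lt1. Qed.

Let c01' : 0 < 1 - c < 1. Proof. by rewrite subr_gt0 c_lt1 gtrBl. Qed.

Let split_part (i : firm) : firm_outcome M :=
  if i is firm1 then share_outcome c c01 else share_outcome (1 - c) c01'.

Let split_full g v : hire (split_part firm1) g v + hire (split_part firm2) g v
  = mdens M g v.
Proof. by rewrite /= /share_hire -mulrDl addrC subrK mul1r. Qed.

Let split_feasible g v : v \in `[0, 1] ->
  hire (split_part firm1) g v + hire (split_part firm2) g v <= mdens M g v.
Proof. by rewrite split_full. Qed.

Definition split_outcome : outcome M := @Outcome R M split_part split_feasible.

Lemma split_outcome_core : core split_outcome.
Proof.
apply: productivity_wage_core => [g|i g]; apply: aeW => v _.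
- exact: split_full.
- by case: i.
Qed.

End proportional_split.

(** An interval of measure 1 does not fit in a null set. One such type is enough to read off the
    share of a split. *)
Lemma ae_unit_interval_ex (P : R -> Prop) :
  {ae @lebesgue_measure R, forall v : R, v \in `[0, 1] -> P v} ->
  exists2 v, v \in `[0, 1] & P v.
Proof.
move=> [N [mN N0 PN]]; apply: contrapT => nP.
have : (@lebesgue_measure R `[0%R, 1%R] <= @lebesgue_measure R N)%E.
  apply: le_measure; rewrite ?inE//= => v v01; apply: PN => /(_ v01) Pv.
  by apply: nP; exists v.
by rewrite N0 lebesgue_measure_itv/= lte_fin ltr01 oppr0 adde0 lee_fin ler10.
Qed.

(** Cancelling the positive density at one type compares the shares; the second alternative comes
    from relabeling the firms. *)
Lemma equivalent_split_outcome c c' (c0 : 0 < c) (c1 : c < 1)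
    (c'0 : 0 < c') (c'1 : c' < 1) :
  equivalent (split_outcome c c0 c1) (split_outcome c' c'0 c'1) ->
  c = c' \/ c + c' = 1.
Proof.
have fI v : v \in `[0, 1] -> injective ( *%R^~ (mdens M grpA v)).
  by move=> v01; apply: mulIf; rewrite gt_eqF ?mdens_gt0.
move=> [[+ _]|[+ _]] => /(_ grpA)/ae_unit_interval_ex[v v01 [hE _]].
- by left; exact: fI v01 _ _ hE.
- by right; rewrite (fI v v01 c (1 - c') hE) subrK.
Qed.

End market_facts.

Theorem proposition1 (R : realType) (M : market R) :
  (exists S : set (outcome M),
     [/\ (S #= [set: R])%card,
         (forall O : outcome M, S O -> core O)
       & (forall O O' : outcome M, S O -> S O' -> O <> O' -> ~ equivalent O O')])
  /\
  (forall O : outcome M, core O ->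
     forall (i : firm) (g : group),
       {ae @lebesgue_measure R, forall v : R, v \in `[0, 1] ->
          hire (O firm1) g v + hire (O firm2) g v = mdens M g v /\
          (0 < hire (O i) g v -> wage (O i) g v = v)}).
Proof.
split; last first.
  move=> O coreO i g; have aeF := lebesgue_ae_filter R.
  apply: filterS2 (core_full_employment R M O coreO g) (core_wage R M O coreO i g).
  by move=> v full wE v01; split; [exact: full|exact: wE].
(* An injection of the reals into the shares below 1/2, where two shares cannot add up to 1 and
   relabeling identifies nothing. *)
pose c (t : R) := (2 * (1 + expR t))^-1.
have e0 (t : R) := expR_gt0 t.
have c0 t : 0 < c t by rewrite invr_gt0; have := e0 t; lra.
have c2 t : c t < 2^-1 by rewrite ltf_pV2 ?posrE//; have := e0 t; lra.
have c1 t : c t < 1 by have := c2 t; lra.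
have cI : injective c.
  move=> s t /invr_inj /mulfI; rewrite pnatr_eq0 => /(_ isT) /addrI.
  exact: expR_inj.
pose F t := split_outcome R M (c t) (c0 t) (c1 t).
have FE s t : equivalent (F s) (F t) -> s = t.
  by move=> /equivalent_split_outcome[/cI //|]; have := c2 s; have := c2 t; lra.
exists (range F); split.
(* Equal outcomes are equivalent, so [F] is injective and its range has the cardinality of the
   reals. *)
- apply: inj_card_eq => s t _ _ Fst; apply: FE; rewrite Fst; left.
  by split=> g; apply: aeW.
- by move=> _ [t _ <-]; exact: split_outcome_core.
- by move=> _ _ [s _ <-] [t _ <-] neq /FE st; apply: neq; rewrite st.
Qed.
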